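(* For every integer $d \geq 1$ there exists a constant $c_3(d)>0$ such that the topological Pach number satisfies $\tau(d,n) \geq c_3(d)\,(\log n)^{1/d}$ for all positive integers $n$.
   Context: Simplicial complexes are identified with their geometric realizations; for an abstract simplex $\{v_0,\ldots,v_k\}$ write $\langle v_0,\ldots,v_k\rangle$ for its geometric realization. Let $V_1,\ldots,V_{d+1}$ be pairwise disjoint sets, each of size $n$, and let $V_1*\cdots*V_{d+1}$ be their join, i.e. the simplicial complex $\{\sigma \subset \bigcup_i V_i : |\sigma\cap V_i|\le 1 \text{ for all } i\}$. For a continuous map $f: V_1*\cdots*V_{d+1} \to \mathbb{R}^d$, let $\tau(f)$ be the maximal $m$ such that there exist $m$-element subsets $Z_1\subset V_1,\ldots,Z_{d+1}\subset V_{d+1}$ with $\bigcap_{z_1\in Z_1,\ldots,z_{d+1}\in Z_{d+1}} f(\langle z_1,\ldots,z_{d+1}\rangle) \neq \emptyset$. The topological Pach number $\tau(d,n)$ is the minimum of $\tau(f)$ over all continuous maps $f: V_1*\cdots*V_{d+1}\to\mathbb{R}^d$. *)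

(* Defs.v *)
From HB Require Import structures.
From mathcomp Require Import all_boot all_order all_algebra.
From mathcomp Require Import all_classical all_reals all_analysis.
Import Order.TTheory GRing.Theory Num.Theory.
Import numFieldNormedType.Exports.

Set Implicit Arguments.
Unset Strict Implicit.
Unset Printing Implicit Defensive.

Local Open Scope classical_set_scope.
Local Open Scope ring_scope.

Definition join_complex (T : finType) (I : finType) (V : I -> {set T}) :
    {set {set T}} :=
  [set s : {set T} | (s \subset \bigcup_i V i)
                     && [forall i, #|s :&: V i| <= 1]%N]%SET.

(* Points of a realization are families of barycentric coordinates indexed by
   the vertices. As T is finite, the pointwise topology is that of R^T. *)
Definition simplex (R : realType) (T : finType) (s : {set T}) :
    set {ptws T -> R} :=
  [set x | [/\ forall v, 0 <= x v, \sum_v x v = 1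
             & forall v, v \notin s -> x v = 0]].
Arguments simplex R {T} s.

Definition realization (R : realType) (T : finType) (K : {set {set T}}) :
    set {ptws T -> R} :=
  \bigcup_(s in [set` K]) simplex R s.
Arguments realization R {T} K.

Section Pach.
Variables (R : realType) (d : nat) (T : finType) (V : 'I_d.+1 -> {set T}).

(* For m = 0 this is an empty intersection, that is, all of R^d. *)
Definition overlaps (f : {ptws T -> R} -> 'rV[R]_d) (m : nat) : Prop :=
  exists Z : 'I_d.+1 -> {set T},
    (forall i, Z i \subset V i /\ #|Z i| = m) /\
    \bigcap_(z in [set z : 'I_d.+1 -> T | forall i, z i \in Z i])
      (f @` simplex R [set z i | i : 'I_d.+1]%SET) !=set0.

Lemma overlaps_ex (f : {ptws T -> R} -> 'rV[R]_d) :
  exists m, `[< overlaps f m >].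
Proof.
exists 0%N; apply/asboolP; exists (fun=> finset.set0); split.
  by move=> i; rewrite finset.sub0set cards0.
by exists 0 => z /(_ ord0); rewrite finset.in_set0.
Qed.

Lemma overlaps_bound (f : {ptws T -> R} -> 'rV[R]_d) m :
  `[< overlaps f m >] -> (m <= #|T|)%N.
Proof. by move=> /asboolP[Z [/(_ ord0)[_ <-] _]]; exact: max_card. Qed.

Definition tau (f : {ptws T -> R} -> 'rV[R]_d) : nat :=
  ex_maxn (overlaps_ex f) (@overlaps_bound f).

(* Maps on the realization are represented by functions on the ambient space,
   of which only the restriction to the realization matters. *)
Definition tau_value (m : nat) : Prop :=
  exists f : {ptws T -> R} -> 'rV[R]_d,
    {within realization R (join_complex V), continuous f} /\ tau f = m.

Lemma tau_value_ex : exists m, `[< tau_value m >].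
Proof.
exists (tau (fun=> 0)); apply/asboolP; exists (fun=> 0); split => //.
by move=> x; exact: cvg_cst.
Qed.

Definition min_tau : nat := ex_minn tau_value_ex.

End Pach.

Definition parts (d n : nat) (i : 'I_d.+1) : {set 'I_d.+1 * 'I_n} :=
  [set v | v.1 == i]%SET.

Definition topological_pach_number (R : realType) (d n : nat) : nat :=
  min_tau R (@parts d n).

(* Main.v *)
Require Import Defs.
From HB Require Import structures.
From mathcomp Require Import all_boot all_order all_algebra.
From mathcomp Require Import all_classical all_reals all_analysis.
From mathcomp Require Import zify lra.
Import Order.TTheory GRing.Theory Num.Theory.
Import numFieldNormedType.Exports.

(* Suppose that every point of R^d lies in the images of fewer than n^(d+1)/K
   of the d-simplices of the join. Triangulate a cube containing the image of f
   finely, with vertices properly coloured by 0, ..., d, and map every vertex v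
   of colour i to a vertex z_v of V_(i+1) such that, for every small simplex t,
   the image under f of the simplex spanned by the z_v with v in t avoids a
   neighbourhood of t. As the number of small simplices at a vertex is bounded
   in terms of d, the z_v can be chosen greedily if K = K(d) is large enough.
   The affine extension z then satisfies f (z p) <> p on the whole cube, which
   contradicts Brouwer's fixed point theorem. Hence a single point is covered by
   a positive fraction of the d-simplices, and Erdos' theorem on complete
   (d+1)-partite subhypergraphs provides sets Z_i of size of order
   (log n)^(1/d).
   Brouwer's theorem comes from a labelling argument: if a_i is a 0/1-labelling
   of the grid that is 0 on the face x_i = 0 and 1 on the face x_i = N, then the
   sum over all cubes of the mod 2 cup product of the coboundaries of the a_i
   telescopes to 1, so on some cube no a_i is constant. *)

Set Implicit Arguments.
Unset Strict Implicit.
Unset Printing Implicit Defensive.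

(** * Greedy selection and Erdos' theorem *)

Lemma sum_ltn (I : finType) (P : pred I) (F G : I -> nat) i0 : P i0 ->
  (forall i, P i -> F i < G i) -> \sum_(i | P i) F i < \sum_(i | P i) G i.
Proof.
move=> Pi0 FG; rewrite (bigD1 i0) //= [X in _ < X](bigD1 i0) //=.
rewrite -addSn leq_add ?FG //.
by apply: leq_sum => i /andP[Pi _]; exact/ltnW/FG.
Qed.

Lemma card_sum1 (T : finType) (A : {set T}) : #|A| = \sum_x (x \in A).
Proof. by rewrite -sum1_card big_mkcond; apply: eq_bigr => x _; case: ifP. Qed.

Section Update.
Variables I X : finType.
Implicit Types s : {ffun I -> X}.

Definition reset s k x : {ffun I -> X} := [ffun i => if i == k then x else s i].

(** Double counting: sending [(s, x)] to [(reset s k x, s k)] is an involution on pairs, so every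
    function arises from exactly [#|X|] pairs. *)
Lemma sum_reset (F : {ffun I -> X} -> nat) k :
  \sum_s \sum_x F (reset s k x) = #|X| * \sum_s F s.
Proof.
rewrite pair_big /= mulnC big_distrl /=.
under [RHS]eq_bigr => s _ do rewrite mulnC -sum_nat_const.
rewrite [RHS]pair_big /=.
rewrite [RHS](reindex_onto (fun p => (reset p.1 k p.2, p.1 k))
                           (fun p => (reset p.1 k p.2, p.1 k))).
  apply: eq_bigl => -[s x] /=; apply/esym/eqP; congr pair; last by rewrite ffunE eqxx.
  by apply/ffunP => i; rewrite !ffunE; case: eqP => // ->.
move=> [s x] _ /=; congr pair; last by rewrite ffunE eqxx.
by apply/ffunP => i; rewrite !ffunE; case: eqP => // ->.
Qed.

Lemma sum_card_reset (H : {set {ffun I -> X}}) k :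
  \sum_s #|[set x | reset s k x \in H]| = #|X| * #|H|.
Proof.
rewrite card_sum1 -(sum_reset (fun s => s \in H : nat) k).
by apply: eq_bigr => s _; rewrite card_sum1; apply: eq_bigr => x _; rewrite inE.
Qed.

Lemma sum_reset_card (H : {set {ffun I -> X}}) k :
  \sum_x #|[set s | reset s k x \in H]| = #|X| * #|H|.
Proof.
rewrite -(sum_card_reset H k) -[RHS](eq_bigr _ (fun s _ => esym (card_sum1 _))).
rewrite exchange_big /=; apply: eq_bigr => x _; rewrite card_sum1.
by apply: eq_bigr => s _; rewrite !inE.
Qed.

End Update.

(* Once z is fixed at the coordinates below k, Markov's
   inequality leaves, for every v, a value of z k v for which the fraction of
   bad completions of each of the at most D cells through v grows by at most a
   factor D. *)
Lemma greedy_avoid (G : finType) (r n D : nat) (cells : {set {ffun 'I_r -> G}})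
    (Bad : {ffun 'I_r -> G} -> {set {ffun 'I_r -> 'I_n}}) :
  0 < n -> 0 < D ->
  (forall i v, #|[set t in cells | t i == v]| <= D) ->
  (forall t, t \in cells -> D ^ r * #|Bad t| < n ^ r) ->
  exists z : 'I_r -> G -> 'I_n,
    forall t, t \in cells -> [ffun i => z i (t i)] \notin Bad t.
Proof.
move=> n_gt0 D_gt0 cellsD BadD; pose x0 := Ordinal n_gt0.
pose comp (z : 'I_r -> G -> 'I_n) k (t : {ffun 'I_r -> G})
    (s : {ffun 'I_r -> 'I_n}) :=
  [ffun i : 'I_r => if i < k then z i (t i) else s i].
suff stage k : k <= r -> exists z, forall t, t \in cells ->
    D ^ (r - k) * #|[set s | comp z k t s \in Bad t]| < n ^ r.
  have [z zP] := stage r (leqnn r); exists z => t /zP.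
  rewrite subnn mul1n => lt_n; apply/negP => zBad.
  move: lt_n; rewrite (_ : [set s | _] = finset.setT).
    by rewrite cardsT card_ffun !card_ord ltnn.
  apply/setP => s; rewrite inE finset.in_setT.
  rewrite (_ : comp z r t s = [ffun i => z i (t i)]) //.
  by apply/ffunP => i; rewrite !ffunE ltn_ord.
elim: k => [|k IHk] lt_kr.
  exists (fun _ _ => x0) => t /BadD; rewrite subn0.
  rewrite (_ : [set s | _] = Bad t) //; apply/setP => s; rewrite inE.
  by rewrite (_ : comp _ _ _ _ = s) //; apply/ffunP => i; rewrite !ffunE ltn0.
have {IHk}[z zP] := IHk (ltnW lt_kr).
pose ko := Ordinal lt_kr.
pose B t := [set s | comp z k t s \in Bad t].
have stepP v : exists x, [forall (t | (t \in cells) && (t ko == v)),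
    D ^ (r - k.+1) * #|[set s | reset s ko x \in B t]| < n ^ r].
  have [t0 /andP[t0c t0v]|nocell] := pickP [pred t in cells | t ko == v];
    last first.
    by exists x0; apply/forall_inP => t tP; move: (nocell t); rewrite /= tP.
  apply/existsP; apply: contraT => /existsPn badx.
  have: \sum_(x : 'I_n) n ^ r <=
      \sum_(x : 'I_n) \sum_(t | (t \in cells) && (t ko == v))
          D ^ (r - k.+1) * #|[set s | reset s ko x \in B t]|.
    apply: leq_sum => x _; have := badx x.
    rewrite negb_forall_in => /exists_inP[t tP]; rewrite -leqNgt => le_n.
    by rewrite (bigD1 t) //=; exact: leq_trans le_n (leq_addr _ _).
  rewrite leqNgt => /negP; case.
  rewrite exchange_big /=.
  under eq_bigr => t _ do rewrite -big_distrr sum_reset_card card_ord /= mulnCA.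
  rewrite -big_distrr sum_nat_const card_ord /= ltn_pmul2l //.
  rewrite -(ltn_pmul2l D_gt0) big_distrr /=.
  apply: leq_trans (_ : \sum_(t | (t \in cells) && (t ko == v)) n ^ r <= _); last first.
    rewrite sum_nat_const leq_mul2r; apply/orP; right.
    by apply: leq_trans (cellsD ko v); rewrite cardsE.
  apply: (@sum_ltn _ _ _ _ t0); rewrite ?t0c //= => t /andP[tc _].
  by rewrite mulnA -expnS subnSK //; exact: zP.
exists (fun i v => if i == ko then xchoose (stepP v) else z i v) => t tc.
have := xchooseP (stepP (t ko)) => /forall_inP/(_ t); rewrite tc eqxx => /(_ isT).
set x := xchoose _.
rewrite (_ : [set s | _] = [set s | reset s ko x \in B t]) //.
apply/setP => s; rewrite !inE; suff -> : comp (fun i v =>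
  if i == ko then xchoose (stepP v) else z i v) k.+1 t s = comp z k t (reset s ko x) by [].
apply/ffunP => i; rewrite !ffunE ltnS.
case: (eqVneq i ko) => [->|ne]; first by rewrite leqnn ltnn.
by rewrite leq_eqVlt (_ : (i == k :> nat) = false) //; apply: negbTE.
Qed.

(** * Erdos' theorem by repeated averaging *)

Lemma ffact_leq_exp n m : n ^_ m <= n ^ m.
Proof.
elim: m n => [//|m IHm] n; rewrite ffactnS expnS leq_mul2l.
rewrite (leq_trans (IHm _)) ?orbT //; case: m {IHm} => // m.
by rewrite leq_exp2r // leq_pred.
Qed.

Lemma exp_leq_ffact n m : (n - m) ^ m <= n ^_ m.
Proof.
elim: m n => [//|m IHm] n; rewrite ffactnS expnS leq_mul ?leq_subr //.
by rewrite (leq_trans _ (IHm _)) // subnS -predn_sub.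
Qed.

Lemma sum_card_common (Y X : finType) (H : Y -> {set X}) m :
  \sum_(M : {set X} | #|M| == m) #|[set y | M \subset H y]| =
  \sum_y 'C(#|H y|, m).
Proof.
under [LHS]eq_bigr => M _ do rewrite card_sum1.
rewrite exchange_big /=; apply: eq_bigr => y _.
rewrite -cards_draws card_sum1 [LHS]big_mkcond /=; apply: eq_bigr => M _.
by rewrite !inE andbC; case: (_ == _).
Qed.

(** A fraction of at least [1/(2K)] of the [y] have [#|H y|] at least [#|X|/(2K)]. As [m] is at most
    [#|X|/(4K)], such an [H y] contains a fraction of at least [(4K)^(-m)] of all [m]-subsets, and
    averaging over [M] finds a popular one. *)
Lemma popular_subset (Y X : finType) (H : Y -> {set X}) (K m : nat) :
  0 < K -> 0 < m -> m * (4 * K) <= #|X| ->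
  #|Y| * #|X| <= K * \sum_y #|H y| ->
  exists2 M : {set X}, #|M| = m &
    #|Y| <= (4 * K) ^ m.+1 * #|[set y | M \subset H y]|.
Proof.
move=> K_gt0 m_gt0 le_mX dens; set n := #|X| in le_mX dens.
have n_gt0 : 0 < n by nia.
have le_mn : m <= n by nia.
pose good := [set y | n <= 2 * K * #|H y|].
have card_good : #|Y| <= 2 * K * #|good|.
  have : 2 * K * (\sum_y #|H y|) <= 2 * K * n * #|good| + n * #|Y|.
    rewrite (bigID (mem good)) /= mulnDr leq_add //.
      rewrite -[X in _ <= X]mulnA leq_mul2l [n * _]mulnC -sum_nat_const.
      rewrite leq_sum ?orbT // => y _.
      exact: max_card.
    rewrite big_distrr /= [n * _]mulnC -sum_nat_const big_mkcond /=.
    by apply: leq_sum => y _; rewrite inE -ltnNge; case: ifP => // /ltnW.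
  have := leq_mul (leqnn 2) dens => /[swap] h1 h2.
  have h : n * #|Y| <= n * (2 * K * #|good|) by nia.
  by rewrite leq_pmul2l in h.
have good_bin y : y \in good -> 'C(n, m) <= (4 * K) ^ m * 'C(#|H y|, m).
  rewrite inE => yg; rewrite -(leq_pmul2r (fact_gt0 m)) -mulnA !bin_ffact.
  apply: leq_trans (ffact_leq_exp _ _) _.
  apply: leq_trans (leq_mul (leqnn _) (exp_leq_ffact _ _)).
  by rewrite -expnMn leq_exp2r //; nia.
have [M /andP[/eqP cM le_good]|nobig] := pickP [pred M : {set X} | (#|M| == m) &&
    (#|good| <= (4 * K) ^ m * #|[set y | M \subset H y]|)].
  exists M => //; apply: leq_trans card_good _.
  by rewrite expnS -[X in _ <= X]mulnA leq_mul // leq_mul2r orbT.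
have : \sum_(M : {set X} | #|M| == m) (4 * K) ^ m * #|[set y | M \subset H y]| <
       \sum_(M : {set X} | #|M| == m) #|good|.
  have /card_gt0P[M0] : 0 < #|[set M : {set X} | #|M| == m]|.
    by rewrite card_draws bin_gt0.
  rewrite inE => M0m; apply: (sum_ltn M0m) => M Mm.
  by rewrite ltnNge; apply/negP => h; have := nobig M; rewrite /= Mm h.
rewrite -big_distrr sum_card_common sum_nat_cond_const /= ltnNge => /negP[].
rewrite [X in X * _ <= _](_ : _ = 'C(n, m)); last by rewrite -card_draws cardsE.
rewrite big_distrr [X in _ <= X](bigID (mem good)) /=.
by rewrite (leq_trans _ (leq_addr _ _)) // mulnC -sum_nat_const leq_sum.
Qed.

Lemma subset_of_card (X : finType) (A : {set X}) m : m <= #|A| ->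
  exists2 M : {set X}, M \subset A & #|M| = m.
Proof.
move=> le_m; have /card_gt0P[M] : 0 < #|[set M : {set X} | M \subset A & #|M| == m]|.
  by rewrite cards_draws bin_gt0.
by rewrite inE => /andP[? /eqP ?]; exists M.
Qed.

(* The first d coordinates are treated one at a time; each of them lowers the
   density from 1/K to 1/(4 K)^(m+1). *)
Lemma erdos_box (d n m K : nat) (H : {set {ffun 'I_d.+1 -> 'I_n}}) :
  0 < K -> 0 < m -> m * (4 * K) ^ (m.+2 ^ d) <= n ->
  n ^ d.+1 <= K * #|H| ->
  exists2 Z : 'I_d.+1 -> {set 'I_n}, forall i, #|Z i| = m &
    forall s : {ffun 'I_d.+1 -> 'I_n}, (forall i, s i \in Z i) -> s \in H.
Proof.
move=> K_gt0 m_gt0 le_n dens; set L := 4 * K in le_n.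
have L_gt0 : 0 < L by rewrite /L; lia.
have e_gt0 k : 0 < m.+2 ^ k by rewrite expn_gt0.
(* Chosen so that [4 * Kk k] is a pure power of [L], while [Kk k.+1] dominates [(4 * Kk k) ^ m.+1],
   the loss in one use of [popular_subset]. *)
pose Kk k := K * L ^ (m.+2 ^ k).-1.
have Kk_gt0 k : 0 < Kk k by rewrite muln_gt0 K_gt0 expn_gt0 L_gt0.
have LKk k : 4 * Kk k = L ^ (m.+2 ^ k).
  by rewrite mulnA -expnS prednK.
have le_mLn k : k <= d -> m * (4 * Kk k) <= n.
  move=> le_kd; rewrite LKk (leq_trans _ le_n) // leq_mul2l.
  by rewrite leq_pexp2l ?orbT // leq_pexp2l.
have n_gt0 : 0 < n.
  by apply: leq_trans (le_mLn 0 _) => //; rewrite muln_gt0 m_gt0 muln_gt0 Kk_gt0.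
(* Membership in [Hk k Z] ignores the first [k] coordinates; keeping them lets every stage measure
   density against the same [n ^ d.+1]. *)
pose fits (k : nat) (Z : 'I_d.+1 -> {set 'I_n}) (s t : {ffun 'I_d.+1 -> 'I_n}) :=
  [forall i : 'I_d.+1, if i < k then t i \in Z i else t i == s i].
pose Hk k Z : {set {ffun 'I_d.+1 -> 'I_n}} :=
  [set s | [forall (t : {ffun 'I_d.+1 -> 'I_n} | fits k Z s t), t \in H]].
have stage k : k <= d -> exists2 Z : 'I_d.+1 -> {set 'I_n},
    forall i : 'I_d.+1, i < k -> #|Z i| = m & n ^ d.+1 <= Kk k * #|Hk k Z|.
  elim: k => [_|k IHk lt_kd].
    exists (fun=> finset.set0) => //; rewrite /Kk expn0 muln1 (leq_trans dens) //.
    rewrite leq_mul2l subset_leq_card ?orbT //; apply/fintype.subsetP => s sH.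
    rewrite inE; apply/forall_inP => t /forallP ts.
    suff -> : t = s by [].
    by apply/ffunP => i; apply/eqP; exact: ts.
  have [Z Zm Zdens] := IHk (ltnW lt_kd).
  pose ko : 'I_d.+1 := Ordinal (ltn_trans lt_kd (ltnSn d)).
  have [||||M Mm Mdens] := @popular_subset {ffun 'I_d.+1 -> 'I_n} 'I_n
    (fun s => [set x | reset s ko x \in Hk k Z]) (Kk k) m.
  - exact: Kk_gt0.
  - exact: m_gt0.
  - by rewrite card_ord; exact/le_mLn/ltnW.
  - by rewrite sum_card_reset card_ffun !card_ord mulnC mulnCA leq_mul2l Zdens orbT.
  exists (fun i => if i == ko then M else Z i) => [i|].
    rewrite ltnS leq_eqVlt -[(i == k :> nat)]/(i == ko).
    by case: eqVneq => [->|_] //=; exact: Zm.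
  move: Mdens; rewrite card_ffun !card_ord LKk -expnM => /leq_trans; apply.
  apply: leq_mul.
    rewrite (@leq_trans (L ^ (m.+2 ^ k.+1).-1)) ?leq_pmull //.
    by rewrite leq_pexp2l // expnSr; have := e_gt0 k; nia.
  apply: subset_leq_card; apply/fintype.subsetP => s; rewrite !inE => /fintype.subsetP Ms.
  apply/forall_inP => t /forallP tfit.
  have tkM : t ko \in M by have := tfit ko; rewrite ltnSn eqxx.
  have := Ms _ tkM; rewrite !inE => /forall_inP; apply.
  apply/forallP => i; have := tfit i; rewrite ffunE ltnS leq_eqVlt.
  rewrite -[(i == k :> nat)]/(i == ko).
  by case: (eqVneq i ko) => [->|_] //=; rewrite ltnn eqxx.
have [Z Zm Zdens] := stage d (leqnn d).
have [s le_s] : exists s, n <= Kk d * #|[set x | reset s ord_max x \in Hk d Z]|.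
  apply/existsP; apply: contraT => /existsPn lt_n.
  have : \sum_(s : {ffun 'I_d.+1 -> 'I_n})
      Kk d * #|[set x | reset s ord_max x \in Hk d Z]| <
    \sum_(s : {ffun 'I_d.+1 -> 'I_n}) n.
    apply: (@sum_ltn _ _ _ _ [ffun=> Ordinal n_gt0]) => // s _.
    by rewrite ltnNge; exact: lt_n.
  rewrite -big_distrr /= sum_card_reset sum_nat_const card_ffun !card_ord.
  by rewrite mulnCA [X in _ < X]mulnC ltn_pmul2l // ltnNge Zdens.
have [|M /fintype.subsetP MH Mm] := @subset_of_card _ [set x | reset s ord_max x \in Hk d Z] m.
  have := le_mLn d (leqnn d) => h; rewrite -(leq_pmul2l (Kk_gt0 d)).
  by apply: leq_trans le_s; apply: leq_trans h; rewrite mulnC leq_mul2l leq_pmull ?orbT.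
exists (fun i => if i == ord_max then M else Z i) => [i|t tZ].
  case: (eqVneq i ord_max) => // ne; apply: Zm.
  by rewrite ltn_neqAle -ltnS ltn_ord andbT -(inj_eq val_inj) in ne *.
have tM : t ord_max \in M by have := tZ ord_max; rewrite eqxx.
have := MH _ tM; rewrite !inE => /forall_inP; apply.
apply/forallP => i; have := tZ i; rewrite ffunE.
case: (eqVneq i ord_max) => [->|ne]; first by rewrite ltnn eqxx.
by rewrite ifT // ltn_neqAle -ltnS ltn_ord andbT.
Qed.

Local Open Scope classical_set_scope.
Local Open Scope ring_scope.

(** * Brouwer's fixed point theorem *)

(** Grid points are functions on all of [nat], so that inductions on the dimension stay within one
    type. *)
Definition shift (j : nat) (x : nat -> nat) : nat -> nat :=
  fun i => (x i + (i == j))%N.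
Definition upd (x : nat -> nat) (j t : nat) : nat -> nat :=
  fun i => if i == j then t else x i.

Lemma shiftC j l x : shift j (shift l x) = shift l (shift j x).
Proof. by apply/funext => i; rewrite /shift addnAC. Qed.

(** * Cubical cup products in characteristic 2 *)

Section CubicalCup.
Variables (K : idomainType) (char2 : forall x : K, x + x = 0).

Lemma sum_sym_char2 (h : nat -> nat -> K) (s : seq nat) :
  (forall j l, h j l = h l j) ->
  \sum_(j <- s) \sum_(l <- s | l != j) h j l = 0.
Proof.
move=> hC; pose A := \sum_(j <- s) \sum_(l <- s | (l < j)%N) h j l.
transitivity (A + A); last exact: char2.
rewrite {2}/A [X in _ + X](exchange_big_dep predT) //= -big_split /=.
apply: eq_bigr => j _.
rewrite (bigID (fun l => l < j)%N) /=; congr (_ + _).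
  by apply: eq_bigl => l; case: ltngtP.
by apply: eq_big => [l|l _]; [case: ltngtP | exact: hC].
Qed.

Variable a : nat -> (nat -> nat) -> K.

(* The cubical cup product da_(m-1) u ... u da_0, evaluated at the cube based
   at x with edge directions s; there are no signs in characteristic 2. *)
Fixpoint cup (m : nat) (s : seq nat) (x : nat -> nat) : K :=
  if m is m'.+1 then
    \sum_(j <- s) (a m' (shift j x) + a m' x)
                  * cup m' [seq l <- s | l != j] (shift j x)
  else (s == [::])%:R.

(** The sum is the coboundary of [cup m]. By induction and the Leibniz rule, [cup m.+1] is the
    coboundary of [a m * cup m], and the terms of a double coboundary are symmetric in the two
    directions, so they cancel. *)
Lemma cup_closed m s x :
  \sum_(j <- s) (cup m [seq l <- s | l != j] (shift j x)
                 + cup m [seq l <- s | l != j] x) = 0.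
Proof.
elim: m s x => [|m IHm] s x; first by rewrite big1 // => j _; rewrite char2.
pose g u x := a m x * cup m u x.
pose D j (h : (nat -> nat) -> K) x := h (shift j x) + h x.
have cupS u y : cup m.+1 u y = \sum_(j <- u) D j (g [seq l <- u | l != j]) y.
  transitivity (cup m.+1 u y + a m y * \sum_(j <- u)
      (cup m [seq l <- u | l != j] (shift j y) + cup m [seq l <- u | l != j] y)).
    by rewrite IHm mulr0 addr0.
  rewrite mulr_sumr -big_split /=.
  apply: eq_bigr => j _; rewrite /D /g.
  by rewrite mulrDl mulrDr addrA -[X in X + _]addrA char2 addr0 addrC.
under eq_bigr => j _ do rewrite !cupS !big_filter -big_split /=.
pose g2 j l := g [seq k <- [seq l <- s | l != j] | k != l].
rewrite (sum_sym_char2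
  (h := fun j l => D l (g2 j l) (shift j x) + D l (g2 j l) x)) // => j l.
rewrite /g2.
have -> : [seq k <- [seq k <- s | k != j] | k != l] =
          [seq k <- [seq k <- s | k != l] | k != j].
  by rewrite -!filter_predI; apply: eq_filter => k /=; rewrite andbC.
by rewrite /D (shiftC l j) addrACA.
Qed.

(** The Leibniz rule: the other term is [a m x] times the coboundary of [cup m], which vanishes. *)
Lemma cupS m s x : cup m.+1 s x =
  \sum_(j <- s)
     (a m (shift j x) * cup m [seq l <- s | l != j] (shift j x)
      + a m x * cup m [seq l <- s | l != j] x).
Proof.
transitivity (cup m.+1 s x + a m x * \sum_(j <- s)
    (cup m [seq l <- s | l != j] (shift j x) + cup m [seq l <- s | l != j] x)).
  by rewrite cup_closed mulr0 addr0.
rewrite mulr_sumr -big_split.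
apply: eq_bigr => j _ /=.
by rewrite mulrDl mulrDr addrA -[X in X + _]addrA char2 addr0.
Qed.

(** Following a nonzero summand at every level traces an edge path in the cube, one step of which
    changes [a i]. *)
Lemma cup_neq0 m s x i : uniq s -> cup m s x != 0 -> (i < m)%N ->
  exists y y', [/\ forall j, (x j <= y j <= x j + (j \in s))%N,
                   forall j, (x j <= y' j <= x j + (j \in s))%N
                 & a i y != a i y'].
Proof.
elim: m s x => [|m IHm] // s x s_uniq /= /eqP cup0 le_im.
have [j js] : exists2 j, j \in s & (a m (shift j x) + a m x)
                  * cup m [seq l <- s | l != j] (shift j x) != 0.
  apply: contra_notP cup0 => all0; rewrite big1_seq // => j /andP[_ js].
  by apply/eqP; apply: contra_notT all0 => ?; exists j.
rewrite mulf_eq0 negb_or => /andP[aj cupj].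
move: le_im; rewrite ltnS leq_eqVlt => /predU1P[->|lt_im].
  exists (shift j x), x; split=> [l|l|].
  - rewrite /shift leq_addr leq_add2l /=; case: (eqVneq l j) => [->|//].
    by rewrite js.
  - by rewrite leqnn leq_addr.
  - by apply: contra_neq aj => ->; rewrite char2.
have [|y [y' [ybox y'box ayy']]] := IHm _ _ _ cupj lt_im.
  exact: filter_uniq.
have sub l z : (shift j x l <= z <= shift j x l +
    (l \in [seq k <- s | k != j]))%N -> (x l <= z <= x l + (l \in s))%N.
  rewrite /shift mem_filter; case: (eqVneq l j) => [->|_] /=.
    by rewrite js addn0 => /andP[/(leq_trans (leq_addr _ _))-> ->].
  by rewrite !addn0.
by exists y, y'; split=> // l; exact: sub.
Qed.

Variable N : nat.

Fixpoint boxsum (m : nat) (h : (nat -> nat) -> K) (x : nat -> nat) : K :=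
  if m is m'.+1 then \sum_(t < N) boxsum m' h (upd x m' t) else h x.

Lemma boxsum_sum m (s : seq nat) (h : nat -> (nat -> nat) -> K) x :
  boxsum m (fun y => \sum_(j <- s) h j y) x = \sum_(j <- s) boxsum m (h j) x.
Proof.
elim: m x => [//|m IHm] x /=.
by under eq_bigr => t _ do rewrite IHm; rewrite exchange_big.
Qed.

Lemma boxsum0 m x : boxsum m (fun=> 0) x = 0.
Proof. by elim: m x => [|m IHm] x //=; rewrite big1. Qed.

Lemma boxsumD m h h' x :
  boxsum m (fun y => h y + h' y) x = boxsum m h x + boxsum m h' x.
Proof.
by elim: m x => [//|m IHm] x /=; rewrite -big_split; apply: eq_bigr => t _.
Qed.

Lemma boxsum_eq (P : pred nat) m (h h' : (nat -> nat) -> K) x j :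
  (m <= j)%N -> P (x j) -> (forall y, P (y j) -> h y = h' y) ->
  boxsum m h x = boxsum m h' x.
Proof.
move=> + + hh'; elim: m x => [|m IHm] x le_mj xP /=; first exact: hh'.
apply: eq_bigr => t _; apply: IHm; first exact: ltnW.
by rewrite /upd gtn_eqF.
Qed.

Lemma boxsum_shift m h x j : (m <= j)%N ->
  boxsum m (h \o shift j) x = boxsum m h (shift j x).
Proof.
elim: m x => [//|m IHm] x le_mj /=; apply: eq_bigr => t _.
rewrite IHm; last exact: ltnW.
congr boxsum; apply/funext => i; rewrite /upd /shift.
by case: (eqVneq i m) => [->|//]; rewrite ltn_eqF ?addn0.
Qed.

Lemma sum_telescope_char2 (F : nat -> K) :
  \sum_(t < N) (F t.+1 + F t) = F N + F 0%N.
Proof.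
elim: N => [|k IHk]; first by rewrite big_ord0 char2.
by rewrite big_ord_recr /= IHk addrC addrA -[X in X + _]addrA char2 addr0.
Qed.

Lemma boxsum_diff m h x :
  boxsum m.+1 (fun y => h (shift m y) + h y) x =
  boxsum m h (upd x m N) + boxsum m h (upd x m 0).
Proof.
rewrite /= -(sum_telescope_char2 (fun t => boxsum m h (upd x m t))).
apply: eq_bigr => t _; rewrite boxsumD (boxsum_shift h) //; congr (boxsum _ _ _ + _).
by apply/funext => i; rewrite /shift /upd; case: eqVneq; rewrite ?addn1 ?addn0.
Qed.

(** Telescoping along direction [j] leaves only the two faces orthogonal to it, where [h]
    vanishes. *)
Lemma boxsum_diff0 m h x j : (j < m)%N ->
  (forall y, y j = 0%N \/ y j = N -> h y = 0) ->
  boxsum m (fun y => h (shift j y) + h y) x = 0.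
Proof.
move=> + h0; elim: m x => [//|m IHm] x.
rewrite ltnS leq_eqVlt => /predU1P[<-|lt_jm]; last first.
  by rewrite /= big1 // => t _; exact: IHm.
have z0 y : y j = 0%N \/ y j = N -> boxsum j h y = 0.
  move=> yj; pose P t := (t == 0)%N || (t == N).
  rewrite (@boxsum_eq P j h (fun _ => 0) _ j) //.
  - exact: boxsum0.
  - by rewrite /P; case: yj => ->; rewrite eqxx ?orbT.
  - by move=> w /orP[]/eqP ?; apply: h0; [left|right].
by rewrite boxsum_diff !z0 ?addr0 // /upd eqxx; [left|right].
Qed.

Hypothesis a_0 : forall i x, x i = 0%N -> a i x = 0.
Hypothesis a_N : forall i x, x i = N -> a i x = 1.

(** On a cube lying in one of these faces [a j] is constant, against [cup_neq0]. *)
Lemma cup_face0 m s x j : (j < m)%N -> j \notin s -> uniq s ->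
  x j = 0%N \/ x j = N -> cup m s x = 0.
Proof.
move=> lt_jm js s_uniq xj; apply/eqP/contraT => cup_n0.
have [y [y' [/(_ j) yj /(_ j) y'j /eqP[]]]] := cup_neq0 s_uniq cup_n0 lt_jm.
move: yj y'j; rewrite (negPf js) addn0 -!eqn_leq => /eqP yj /eqP y'j.
by case: xj => xj; [rewrite !a_0 -?yj -?y'j | rewrite !a_N -?yj -?y'j].
Qed.

(** Induction on [m], with [cup m.+1] written as a coboundary. Directions below [m] contribute
    nothing by [cup_face0]. Direction [m] leaves the face [x m = N], where [a m = 1] and the
    induction hypothesis applies, and the face [x m = 0], where [a m = 0]. *)
Lemma boxsum_cup m x : boxsum m (cup m (iota 0 m)) x = 1.
Proof.
elim: m x => [//|m IHm] x.
have -> : cup m.+1 (iota 0 m.+1) = (fun y => \sum_(j <- iota 0 m.+1)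
   (a m (shift j y) * cup m [seq l <- iota 0 m.+1 | l != j] (shift j y)
      + a m y * cup m [seq l <- iota 0 m.+1 | l != j] y)).
  by apply/funext => y; exact: cupS.
rewrite boxsum_sum -(addn1 m) iotaD big_cat /= big_seq1 add0n addn1.
rewrite big1_seq ?add0r => [|j /andP[_]]; last first.
  rewrite mem_iota => /andP[_ lt_jm].
  rewrite (boxsum_diff0
    (h := fun y => a m y * cup m [seq l <- iota 0 m ++ [:: m] | l != j] y)) //.
    exact: ltnW.
  move=> y yj; rewrite (@cup_face0 _ _ _ j) ?mulr0 //.
    by rewrite mem_filter eqxx.
  by rewrite filter_uniq // -(iotaD 0 m 1) iota_uniq.
have -> : [seq l <- iota 0 m ++ [:: m] | l != m] = iota 0 m.
  rewrite filter_cat /= eqxx cats0; apply/all_filterP/allP => l.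
  by rewrite mem_iota => /andP[_ /ltn_eqF ->].
rewrite (boxsum_diff m (fun y => a m y * cup m (iota 0 m) y)).
rewrite (boxsum_eq (P := pred1 N) (h' := cup m (iota 0 m)) (j := m)) //=.
- rewrite IHm (boxsum_eq (P := pred1 0%N) (h' := fun _ => 0) (j := m)) //=.
  + by rewrite boxsum0 addr0.
  + by rewrite /upd eqxx.
  + by move=> y /eqP ym; rewrite a_0 ?mul0r.
- by rewrite /upd eqxx.
- by move=> y /eqP ym; rewrite a_N ?mul1r.
Qed.

Lemma boxsum_neq0 m h x : boxsum m h x != 0 ->
  exists2 y, (forall j, (j < m)%N -> (y j < N)%N) & h y != 0.
Proof.
suff: boxsum m h x != 0 -> exists y, [/\ (forall j, (j < m)%N -> (y j < N)%N),
   (forall j, (m <= j)%N -> y j = x j) & h y != 0].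
  by move=> H /H[y [yN _ hy]]; exists y.
elim: m x => [|m IHm] x /= => [hx|/eqP n0]; first by exists x.
have [t /IHm[y [yN ye hy]]] :
    exists t : 'I_N, boxsum m h (upd x m t) != 0.
  apply: contra_notP n0 => all0; rewrite big1 // => t _.
  by apply/eqP; apply: contra_notT all0 => ?; exists t.
exists y; split=> // j.
  rewrite ltnS leq_eqVlt => /predU1P[->|]; last exact: yN.
  by rewrite ye // /upd eqxx.
by move=> lt_mj; rewrite ye 1?ltnW // /upd gtn_eqF.
Qed.

End CubicalCup.

Lemma discrete_poincare_miranda (a : nat -> (nat -> nat) -> bool) (N d : nat) :
  (forall i x, x i = 0%N -> ~~ a i x) -> (forall i x, x i = N -> a i x) ->
  exists2 x, (forall j, (j < d)%N -> (x j < N)%N) &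
  forall i, (i < d)%N ->
  exists y y', [/\ forall j, (x j <= y j <= (x j).+1)%N,
                   forall j, (x j <= y' j <= (x j).+1)%N,
                   ~~ a i y & a i y'].
Proof.
move=> a0 aN.
have char2 (u : 'F_2) : u + u = 0.
  by apply/val_inj; case: u => [[|[|m]] h].
pose A i x : 'F_2 := (a i x)%:R.
have A0 i x : x i = 0%N -> A i x = 0 by move=> /a0 /negPf ai; rewrite /A ai.
have AN i x : x i = N -> A i x = 1 by move=> /aN ai; rewrite /A ai.
have [|x xN cx] := @boxsum_neq0 _ N d (cup A d (iota 0 d)) (fun _ => 0%N).
  by rewrite boxsum_cup ?oner_eq0.
exists x => // i lt_id.
have [y [y' [ybox y'box neq]]] := cup_neq0 char2 (iota_uniq _ _) cx lt_id.
have sub z : (forall j, x j <= z j <= x j + (j \in iota 0 d))%N ->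
    forall j, (x j <= z j <= (x j).+1)%N.
  move=> zbox j; have /andP[-> /= le_z] := zbox j.
  by apply: leq_trans le_z _; rewrite -addn1 leq_add2l leq_b1.
move: neq; rewrite /A; case ay: (a i y); case ay': (a i y'); rewrite ?eqxx //.
  by exists y', y; rewrite ay ay'; split=> //; exact: sub.
by exists y, y'; rewrite ay ay'; split=> //; exact: sub.
Qed.

(** * From labellings to fixed points on the cube *)

Definition unit_cube (R : realType) (d : nat) : set 'rV[R]_d :=
  [set p | forall i, 0 <= p ord0 i <= 1].

Definition close_to (R : realType) (d N : nat) (q y : 'rV[R]_d) :=
  forall i, `|y ord0 i - q ord0 i| <= 2 / N.+1%:R.

Lemma compact_unit_cube (R : realType) d : compact (@unit_cube R d).
Proof.
apply: (@rV_compact R d (fun=> [set x : R | 0 <= x <= 1])) => _.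
rewrite (_ : [set x | _] = `[0, 1]%classic); first exact: segment_compact.
by apply/seteqP; split => x /=; rewrite in_itv.
Qed.

(** Nearness is joint in [q] and [N], the form in which compactness of the cube yields a single [N]
    valid at all its points. *)
Lemma near_close_to (R : realType) d (p : 'rV[R]_d) (Q : set 'rV[R]_d) :
  nbhs p Q -> \forall q \near p & N \near \oo, close_to N q `<=` Q.
Proof.
move=> /nbhs_ballP[e /= e0 eQ].
have e20 : 0 < e / 2 by rewrite divr_gt0.
have e40 : 0 < e / 4 by rewrite divr_gt0.
near=> q N => y yq; apply: eQ.
have : ball p (e / 2) q by near: q; exact: nbhsx_ballx.
move=> [_ pq]; split => // i j; have := pq i j; rewrite /= /ball /= => pqj.
rewrite (ord1 i) in pqj *.
rewrite -[p ord0 j](subrK (q ord0 j)) -addrA (le_lt_trans (ler_normD _ _)) //.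
rewrite (splitr e) ltr_leD // distrC (le_trans (yq j)) //.
have : N.+1%:R^-1 < e / 4 by near: N; exact: (near_infty_natSinv_lt (PosNum e40)).
by move=> /ltW; rewrite -(ler_pM2l (ltr0Sn R 1)) => /le_trans; apply; lra.
Unshelve. all: by end_near. Qed.

Lemma brouwer_cube (R : realType) d (g : 'rV[R]_d -> 'rV[R]_d) :
  {within @unit_cube R d, continuous g} ->
  (forall p, unit_cube p -> unit_cube (g p)) ->
  exists2 p, unit_cube p & g p = p.
Proof.
move=> /subspace_continuousP gc gI; apply: contrapT => nofix.
(* Near a point moved by [g], some coordinate of [g y - y] keeps a strict sign; compactness turns
   this into one mesh for the whole cube. *)
pose P (N : nat) (q : 'rV[R]_d) := exists i : 'I_d,
  (forall y, unit_cube y -> close_to N q y -> y ord0 i < g y ord0 i) \/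
  (forall y, unit_cube y -> close_to N q y -> g y ord0 i < y ord0 i).
have [N _ /(_ N (leqnn N)) NP] : \forall N \near \oo, @unit_cube R d `<=` P N.
  have /compact_near_coveringP := @compact_unit_cube R d; apply => p pI.
  have [i neq_i] : exists i, g p ord0 i != p ord0 i.
    apply: contrapT => alleq; apply: nofix; exists p => //; apply/rowP => i.
    by apply: contrapT => /eqP ne; apply: alleq; exists i.
  have hc : (g y ord0 i - y ord0 i) @[y --> within (@unit_cube R d) (nbhs p)] -->
      g p ord0 i - p ord0 i.
    apply: cvgB.
      exact: (@cvg_comp _ _ _ g (fun M => M ord0 i) _ _ _ (gc p pI)
        (@coord_continuous R 1 d ord0 i (g p))).
    by apply: cvg_within_filter; exact: coord_continuous.
  case: (ltgtP (g p ord0 i) (p ord0 i)) neq_i => // lt_i _.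
    have : \forall y \near within (@unit_cube R d) (nbhs p), g y ord0 i - y ord0 i < 0.
      by apply: (cvgr_lt _ hc); rewrite subr_lt0.
    move=> /near_close_to; apply: filterS => -[q N] /= h.
    by exists i; right => y yI yq; rewrite -subr_lt0; exact: h.
  have : \forall y \near within (@unit_cube R d) (nbhs p), g y ord0 i - y ord0 i > 0.
    by apply: (cvgr_gt _ hc); rewrite subr_gt0.
  move=> /near_close_to; apply: filterS => -[q N] /= h.
  by exists i; left => y yI yq; rewrite -subr_gt0; exact: h.
pose pt (x : nat -> nat) : 'rV[R]_d := \row_i ((x i)%:R / N.+1%:R).
(* Label 1 records that [g] does not increase coordinate [i]. The labels at [x i = 0] and
   [x i = N.+1] are forced; as [g] preserves the cube, a forced 0 excludes a strict decrease there
   and a forced 1 a strict increase. *)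
pose a (i : nat) (x : nat -> nat) := (x i != 0%N) && ((N.+1 <= x i)%N ||
  [exists k : 'I_d, (k == i :> nat) && (g (pt x) ord0 k <= pt x ord0 k)]).
have [||x xN xk] := @discrete_poincare_miranda a N.+1 d.
- by move=> i x xi0; rewrite /a xi0.
- by move=> i x xiN; rewrite /a xiN leqnn.
have ptI (y : nat -> nat) : (forall j : 'I_d, y j <= N.+1)%N -> unit_cube (pt y).
  move=> yN j; rewrite mxE divr_ge0 //= ler_pdivrMr ?ltr0Sn //.
  by rewrite mul1r ler_nat yN.
have ptx : unit_cube (pt x) by apply: ptI => j; exact/ltnW/xN.
have near_x (y : nat -> nat) : (forall j : nat, (x j <= y j <= (x j).+1))%N ->
    unit_cube (pt y) /\ close_to N (pt x) (pt y).
  move=> yx; split.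
    apply: ptI => j; have /andP[_ /leq_trans] := yx j; apply.
    exact: xN.
  move=> j; rewrite !mxE -mulrBl normrM [`|_^-1|]ger0_norm //.
  rewrite ler_pM2r ?invr_gt0 ?ltr0Sn //.
  have /andP[le1 le2] := yx j; rewrite -natrB // normr_nat.
  by rewrite ler_nat leq_subLR addn2 leqW.
have [i [lt_i|lt_i]] := NP _ ptx.
  have [_ [y [_ /near_x[yI yx] _]]] := xk i (ltn_ord i).
  rewrite /a => /andP[_ /orP[le_Ny|/existsP[k /andP[/eqP/val_inj ->]]]]; last first.
    by rewrite leNgt lt_i.
  have := lt_i _ yI yx; have /andP[_ g1] := gI _ yI i.
  move=> /lt_le_trans/(_ g1); rewrite mxE ltr_pdivrMr ?ltr0Sn // mul1r ltr_nat.
  by rewrite ltnNge le_Ny.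
have [y [_ [/near_x[yI yx] _ ay _]]] := xk i (ltn_ord i).
move: ay; rewrite /a negb_and negbK => /orP[/eqP y0|].
  have := lt_i _ yI yx; have /andP[g0 _] := gI _ yI i.
  by move=> /(le_lt_trans g0); rewrite mxE y0 mul0r ltxx.
rewrite negb_or => /andP[_ /existsPn/(_ i)]; rewrite eqxx /= => /negP; apply.
exact/ltW/lt_i.
Qed.

(** * Hat functions of Freudenthal's triangulation *)

(** The differences [v j - w j] lie within 1 of each other, so up to exchanging [v] and [w] they are
    all 0 or 1. Their sum is then at most [d] and divisible by [d.+1], hence zero. *)
Lemma eq_of_sum_mod (d : nat) (v w : 'I_d -> nat) :
  (forall j, v j <= (w j).+1)%N -> (forall j, w j <= (v j).+1)%N ->
  (forall j l, v j + w l <= (v l + w j).+1)%N ->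
  (\sum_j v j = \sum_j w j %[mod d.+1])%N -> v =1 w.
Proof.
have wlog_le (v' w' : 'I_d -> nat) : (forall j, w' j <= v' j)%N ->
    (forall j, v' j <= (w' j).+1)%N ->
    (\sum_j v' j = \sum_j w' j %[mod d.+1])%N -> v' =1 w'.
  move=> le_wv le_vw.
  have -> : (\sum_j v' j = \sum_j w' j + \sum_j (v' j - w' j))%N.
    by rewrite -big_split; apply: eq_bigr => j _ /=; rewrite subnKC.
  move/eqP; rewrite -{2}[(\sum_j w' j)%N]addn0 eqn_modDl mod0n => dvd.
  have le_d : (\sum_j (v' j - w' j) <= d)%N.
    rewrite -[X in (_ <= X)%N]card_ord -sum1_card leq_sum // => j _.
    by rewrite leq_subLR addn1.
  move: dvd; rewrite modn_small ?ltnS // sum_nat_eq0 => /forallP all0 j.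
  by apply/eqP; rewrite eqn_leq le_wv andbT -subn_eq0; exact: all0.
move=> le_vw le_wv le_jl eq_mod.
have [[j lt_j]|nolt] := pselect (exists j, w j < v j)%N.
  by apply: wlog_le => // l; have := le_jl j l; lia.
move=> l; apply/esym; apply: (wlog_le w v) => // k.
by rewrite leqNgt; apply/negP => lt_k; apply: nolt; exists k.
Qed.

Section Hat.
Variables (R : realType) (d N : nat).
Notation G := {ffun 'I_d -> 'I_N.+2}.
Implicit Types (v w : G) (p : 'rV[R]_d).

Definition offset v p j : R := N.+1%:R * p ord0 j - (v j)%:R.

(** Twice the positive part of [a], in a form whose continuity is immediate; the factor cancels on
    normalization. *)
Definition pospart (a : R) : R := a + `|a|.

(* Up to normalization, the barycentric coordinate of the vertex v in
   Freudenthal's triangulation of the grid: its support consists of the p for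
   which all differences between 0 and the offset v p j are less than 1. *)
Definition hat v p : R :=
  \prod_j pospart (1 - `|offset v p j|) *
  \prod_j \prod_l pospart (1 - (offset v p j - offset v p l)).

Lemma pospart_ge0 a : 0 <= pospart a.
Proof. by rewrite /pospart addrC -lerBlDr sub0r -normrN ler_norm. Qed.

Lemma pospart_neq0 a : (pospart a != 0) = (0 < a).
Proof.
rewrite /pospart; case: (ltP 0 a) => [a0|a0].
  by rewrite gtr0_norm // lt0r_neq0 // addr_gt0.
by rewrite ler0_norm // subrr eqxx.
Qed.

Lemma hat_ge0 v p : 0 <= hat v p.
Proof.
rewrite mulr_ge0 //; apply: prodr_ge0 => j _; first exact: pospart_ge0.
by apply: prodr_ge0 => l _; exact: pospart_ge0.
Qed.

Lemma hat_neq0 v p : reflect ((forall j, `|offset v p j| < 1) /\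
   (forall j l, offset v p j - offset v p l < 1)) (hat v p != 0).
Proof.
rewrite /hat mulf_eq0 negb_or; apply: (iffP andP) => -[h1 h2]; split.
- by move=> j; move/prodf_neq0: h1 => /(_ j isT); rewrite pospart_neq0 subr_gt0.
- move=> j l; move/prodf_neq0: h2 => /(_ j isT)/prodf_neq0/(_ l isT).
  by rewrite pospart_neq0 subr_gt0.
- by apply/prodf_neq0 => j _; rewrite pospart_neq0 subr_gt0.
- apply/prodf_neq0 => j _; apply/prodf_neq0 => l _.
  by rewrite pospart_neq0 subr_gt0.
Qed.

(** Rounding all coordinates down puts every offset in [[0, 1)]. Where [p ord0 j = 1] the rounded
    value is [N.+1], whence the range ['I_N.+2]. *)
Lemma hat_cover p : unit_cube p -> exists v, hat v p != 0.
Proof.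
move=> pI.
have M0 : 0 < N.+1%:R :> R by rewrite ltr0Sn.
have Mp j : 0 <= N.+1%:R * p ord0 j <= N.+1%:R.
  by have /andP[p0 p1] := pI j; rewrite mulr_ge0 ?ler_piMr // ltW.
exists [ffun j => inord (Num.truncn (N.+1%:R * p ord0 j))].
have off j : 0 <= offset [ffun j => inord (Num.truncn (N.+1%:R * p ord0 j))] p j < 1.
  have /andP[p0 p1] := Mp j; have /andP[t0 t1] := truncn_itv p0.
  rewrite /offset ffunE inordK; last first.
    by rewrite ltnS -(ler_nat R) (le_trans t0).
  by rewrite subr_ge0 t0 ltrBlDl natr1.
apply/hat_neq0; split => [j|j l]; have /andP[j0 j1] := off j.
  by rewrite ger0_norm.
have /andP[l0 _] := off l; lra.
Qed.

Lemma hat_near v w p j : hat v p != 0 -> hat w p != 0 -> (v j <= (w j).+1)%N.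
Proof.
move=> /hat_neq0[/(_ j) vj _] /hat_neq0[/(_ j) wj _].
move: vj wj; rewrite /offset !ltr_norml => /andP[v1 v2] /andP[w1 w2].
suff : (v j < (w j).+2)%N by [].
rewrite -(ltr_nat R) -[(w j).+2]addn2 natrD; lra.
Qed.

(** This makes the colouring by coordinate sum modulo [d.+1] proper: the support conditions of both
    hats at [p] give the hypotheses of [eq_of_sum_mod]. *)
Lemma hat_inj v w p : hat v p != 0 -> hat w p != 0 ->
  (\sum_j v j = \sum_j w j %[mod d.+1])%N -> v = w.
Proof.
move=> vp wp eq_mod; apply/ffunP => j; apply/val_inj.
apply: (@eq_of_sum_mod d (fun j => v j) (fun j => w j)) => // [l|l|l k].
- exact: hat_near vp wp.
- exact: hat_near wp vp.
have /hat_neq0[_ /(_ k l)] := vp; have /hat_neq0[_ /(_ l k)] := wp.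
rewrite /offset => h1 h2.
suff : (v l + w k < (v k + w l).+2)%N by [].
rewrite -(ltr_nat R) -[(_ + w l).+2]addn2 !natrD; lra.
Qed.

Lemma hat_dist v p j : hat v p != 0 -> `|p ord0 j - (v j)%:R / N.+1%:R| <= N.+1%:R^-1.
Proof.
move=> /hat_neq0[/(_ j) /ltW h _].
have M0 : 0 < N.+1%:R :> R by rewrite ltr0Sn.
rewrite -(ler_pM2l M0) mulfV ?gt_eqF // -{1}(gtr0_norm M0) -normrM mulrBr.
by rewrite mulrCA mulfV ?gt_eqF // mulr1.
Qed.

Lemma cvg_hat v p (F : set_system 'rV[R]_d) : Filter F ->
  (forall j, (fun q : 'rV[R]_d => q ord0 j) @ F --> p ord0 j) ->
  hat v q @[q --> F] --> hat v p.
Proof.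
move=> FF Fp.
have off_c j : offset v q j @[q --> F] --> offset v p j.
  by apply: cvgB; [apply: cvgMr; exact: Fp | exact: cvg_cst].
have pos_c (h : 'rV[R]_d -> R) (l : R) : h q @[q --> F] --> l ->
    pospart (h q) @[q --> F] --> pospart l.
  by move=> hc; apply: cvgD => //; exact: cvg_norm.
have prod_c (h : 'I_d -> 'rV[R]_d -> R) (l : 'I_d -> R) :
    (forall j, h j q @[q --> F] --> l j) ->
    \prod_j h j q @[q --> F] --> \prod_j l j.
  by move=> hc; apply: cvg_big => // -[x y]; exact: mul_continuous.
apply: cvgM.
  apply: prod_c => j; apply: pos_c; apply: cvgB; first exact: cvg_cst.
  by apply: cvg_norm; exact: off_c.
apply: (prod_c) => j; apply: (prod_c) => l; apply: pos_c.
by apply: cvgB; [exact: cvg_cst | apply: cvgB; exact: off_c].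
Qed.

End Hat.

(** * A point covered by a positive fraction of the simplices *)

Lemma cvg_fin_sum (R : realType) (X : Type) (F : set_system X) (I : finType)
    (P : pred I) (h : I -> X -> R) (l : I -> R) : Filter F ->
  (forall i, P i -> h i @ F --> l i) ->
  (fun x => \sum_(i | P i) h i x) @ F --> \sum_(i | P i) l i.
Proof. by move=> FF hl; apply: cvg_big => // -[a b]; exact: add_continuous. Qed.

Lemma compact_simplex (R : realType) (T : finType) (s : {set T}) :
  compact (simplex R s).
Proof.
pose proj_v (v : T) : {ptws T -> R} -> R := fun x => x v.
have proj_c v : continuous (proj_v v) by exact: (@proj_continuous T (fun=> R) v).
have sum_c : continuous (fun x : {ptws T -> R} => \sum_v proj_v v x : R).
  move=> x; apply: (@cvg_fin_sum R {ptws T -> R} (nbhs x) T predT proj_v) => v _.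
  exact: proj_c.
apply: (@subclosed_compact _ _ [set x : {ptws T -> R} | forall v, `[0 : R, 1]%classic (x v)]).
- rewrite (_ : simplex R s =
     (\bigcap_v (proj_v v @^-1` [set a | 0 <= a])) `&`
     ((fun x : {ptws T -> R} => \sum_v proj_v v x : R) @^-1` [set a | a = 1] `&`
     \bigcap_(v in [set v | v \notin s]) (proj_v v @^-1` [set a | a = 0]))).
    apply: closedI.
      apply: closed_bigI => v _; apply: preimage_closed; last exact: closed_ge.
      by move=> x _; exact: proj_c.
    apply: closedI.
      by apply: preimage_closed; [move=> x _; exact: sum_c | exact: closed_eq].
    apply: closed_bigI => v _; apply: preimage_closed; last exact: closed_eq.
    by move=> x _; exact: proj_c.
  apply/seteqP; split => [x [x0 x1 xs]|x [x0 [x1 xs]]]; split => //.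
    by move=> v _; exact: x0.
  by move=> v; exact: (x0 v Logic.I).
- apply: (@tychonoff T (fun=> R) (fun=> `[0, 1]%classic)) => _.
  exact: segment_compact.
- move=> x [x0 x1 _] v /=; rewrite in_itv /= x0 /= -x1 (bigD1 v) //= lerDl.
  by apply: sumr_ge0 => w _.
Qed.

Section Overlap.
Variables (R : realType) (d n : nat).
Notation T := ('I_d.+1 * 'I_n)%type.
Implicit Types s : {ffun 'I_d.+1 -> 'I_n}.

Definition face s : {set T} := [set (i, s i) | i : 'I_d.+1]%SET.

Lemma mem_face s u : (u \in face s) = (u.2 == s u.1).
Proof.
apply/imsetP/eqP => [[i _ ->] //|us].
by exists u.1; rewrite // -us -surjective_pairing.
Qed.

Lemma face_join s : face s \in join_complex (@parts d n).
Proof.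
rewrite inE; apply/andP; split.
  apply/fintype.subsetP => u _; apply/finset.bigcupP.
  by exists u.1 => //; rewrite inE.
apply/forallP => i; rewrite -(cards1 (i, s i)); apply: subset_leq_card.
apply/fintype.subsetP => -[i' a]; rewrite !inE mem_face /= => /andP[/eqP-> /eqP ->].
by rewrite eqxx.
Qed.

Section Grid.
Variable N : nat.
Notation G := {ffun 'I_d -> 'I_N.+2}.
Implicit Types (v : G) (t : {ffun 'I_d.+1 -> G}) (p : 'rV[R]_d).

Definition grid_point v : 'rV[R]_d := \row_j ((v j)%:R / N.+1%:R).

Lemma grid_point_cube v : unit_cube (grid_point v).
Proof.
move=> j; rewrite mxE divr_ge0 //= ler_pdivrMr ?ltr0Sn // mul1r ler_nat.
by rewrite -ltnS ltn_ord.
Qed.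

Definition color v : 'I_d.+1 := inord ((\sum_j v j) %% d.+1).

Definition cells : {set {ffun 'I_d.+1 -> G}} :=
  [set t : {ffun 'I_d.+1 -> G} |
    [forall i : 'I_d.+1, forall i' : 'I_d.+1, forall j : 'I_d,
       t i j <= (t i' j).+1]]%N%SET.

(** Coordinates within a cell differ from those of [v] by at most 1, so a cell is encoded by its
    differences from [v], shifted by 1 into ['I_3]. *)
Lemma card_cells_through i v :
  (#|[set t in cells | t i == v]| <= (3 ^ d) ^ d.+1)%N.
Proof.
pose code t : {ffun 'I_d.+1 -> {ffun 'I_d -> 'I_3}} :=
  [ffun i' => [ffun j => inord ((t i' j).+1 - v j)]].
have <- : #|{ffun 'I_d.+1 -> {ffun 'I_d -> 'I_3}}| = ((3 ^ d) ^ d.+1)%N.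
  by rewrite !card_ffun !card_ord.
rewrite -(card_in_imset (f := code)) ?max_card // => t t'.
rewrite !inE => /andP[/forallP tc /eqP tv] /andP[/forallP t'c /eqP t'v] eq_code.
apply/ffunP => i'; apply/ffunP => j; apply/val_inj => /=.
have := congr1 (fun h : {ffun 'I_d.+1 -> {ffun 'I_d -> 'I_3}} => val (h i' j)) eq_code.
have := forallP (forallP (tc i') i) j; have := forallP (forallP (tc i) i') j.
have := forallP (forallP (t'c i') i) j; have := forallP (forallP (t'c i) i') j.
rewrite /= !ffunE tv t'v => h1 h2 h3 h4; rewrite !inordK; lia.
Qed.

(* z i v is needed for i <> color v as well: where the support of the hat
   functions misses the color i, a cell is completed by repeating a vertex. *)
Variable z : 'I_d.+1 -> G -> 'I_n.

(** The normalized hats form a partition of unity, and the coordinate at [u] collects those of the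
    grid vertices sent to [u]. This serves as the affine extension of the vertex assignment. *)
Definition vertex_map p : {ptws T -> R} :=
  fun u => (\sum_(v | (color v, z (color v) v) == u) hat v p) / \sum_(v : G) hat v p.

Lemma sum_hat_gt0 p : unit_cube p -> 0 < \sum_(v : G) hat v p.
Proof.
move=> /(@hat_cover R d N)[v vp]; rewrite (bigD1 v) //= ltr_pwDl //.
  by rewrite lt_neqAle eq_sym vp hat_ge0.
by apply: sumr_ge0 => w _; exact: hat_ge0.
Qed.

Lemma color_inj v w p : hat v p != 0 -> hat w p != 0 -> color v = color w -> v = w.
Proof.
move=> vp wp /(congr1 val); rewrite /= !inordK ?ltn_mod //.
exact: hat_inj vp wp.
Qed.

(** Vertices whose hats are nonzero at [p] have distinct colours, so taking the active vertex of
    each colour gives a cell; [v0] stands in for absent colours. *)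
Lemma vertex_map_simplex p : unit_cube p -> exists2 t, t \in cells &
  simplex R (face [ffun i => z i (t i)]) (vertex_map p) /\
  close_to N (grid_point (t ord0)) p.
Proof.
move=> pI; have [v0 v0p] := @hat_cover R d N p pI.
pose t : {ffun 'I_d.+1 -> G} := [ffun i =>
  if [pick v | (hat v p != 0) && (color v == i)] is Some v then v else v0].
have tp i : hat (t i) p != 0.
  by rewrite ffunE; case: pickP => [v /andP[]|].
have tE v : hat v p != 0 -> t (color v) = v.
  move=> vp; rewrite ffunE; case: pickP => [w /andP[wp /eqP]|/(_ v)].
    exact: (color_inj wp vp).
  by rewrite vp eqxx.
exists t.
  rewrite inE; apply/forallP => i; apply/forallP => i'; apply/forallP => j.
  exact: hat_near (tp i) (tp i').
have S0 := sum_hat_gt0 pI.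
split; last first.
  move=> j; rewrite mxE (le_trans (hat_dist j (tp ord0))) //.
  by rewrite ler_peMl ?invr_ge0 // ler1n.
split.
- move=> u; rewrite divr_ge0 ?(ltW S0) //.
  by apply: sumr_ge0 => w _; exact: hat_ge0.
- rewrite /vertex_map -mulr_suml (_ : \sum_u _ = \sum_(v : G) hat v p).
    by rewrite divff ?gt_eqF.
  by rewrite [RHS](partition_big (fun v => (color v, z (color v) v)) predT).
- move=> u uface; rewrite /vertex_map big1 ?mul0r // => v /eqP vu.
  apply/eqP; apply: contraNT uface => vp; rewrite mem_face -vu /= ffunE.
  by rewrite tE.
Qed.

Lemma cvg_vertex_map p (F : set_system 'rV[R]_d) : Filter F -> unit_cube p ->
  (forall j, (fun q : 'rV[R]_d => q ord0 j) @ F --> p ord0 j) ->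
  vertex_map @ F --> (vertex_map p : {ptws T -> R}).
Proof.
move=> FF pI Fp.
(* pointwise_cvgP requires a topology on the index type *)
apply/(@pointwise_cvgP (discrete_topology T) R) => u.
have sum_c (P : pred G) : (fun q => \sum_(v | P v) hat v q) @ F --> \sum_(v | P v) hat v p.
  by apply: cvg_fin_sum => v _; exact: cvg_hat.
apply: cvgM; first exact: sum_c.
by apply: cvgV; [rewrite gt_eqF // sum_hat_gt0 | exact: sum_c].
Qed.

End Grid.

Definition covering_faces (f : {ptws T -> R} -> 'rV[R]_d) (p : 'rV[R]_d) :
    {set {ffun 'I_d.+1 -> 'I_n}} :=
  [set s | `[< (f @` simplex R (face s)) p >]]%SET.

Notation join_realization := (realization R (join_complex (@parts d n))).

Lemma simplex_face_sub s : simplex R (face s) `<=` join_realization.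
Proof. by move=> x xs; exists (face s) => //; exact: face_join. Qed.

Lemma compact_face_image (f : {ptws T -> R} -> 'rV[R]_d) s :
  {within join_realization, continuous f} -> compact (f @` simplex R (face s)).
Proof.
move=> fc; apply: continuous_compact; last exact: compact_simplex.
exact: continuous_subspaceW (@simplex_face_sub s) fc.
Qed.

(** The factor [D ^ r] of [greedy_avoid], with [D] the bound on cells through a vertex and
    [r = d.+1]. *)
Definition overlap_const : nat := ((3 ^ d) ^ d.+1) ^ d.+1.

Lemma overlap_cube (f : {ptws T -> R} -> 'rV[R]_d) : (0 < n)%N ->
  {within join_realization, continuous f} ->
  (forall s x, simplex R (face s) x -> unit_cube (f x)) ->
  exists p, (n ^ d.+1 <= overlap_const * #|covering_faces f p|)%N.
Proof.
move=> n_gt0 fc fI; apply: contrapT => none.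
have few p : (overlap_const * #|covering_faces f p| < n ^ d.+1)%N.
  by rewrite ltnNge; apply/negP => le_p; apply: none; exists p.
(* A compact face image that misses [p] stays away from [p]. So for [q] near [p] and [N] large,
   [near_faces N q] lies in [covering_faces f p], and compactness gives a common [N]. *)
pose near_faces N q : {set {ffun 'I_d.+1 -> 'I_n}} :=
  [set s | `[< exists2 x, simplex R (face s) x & close_to N q (f x) >]]%SET.
pose P N q := (overlap_const * #|near_faces N q| < n ^ d.+1)%N.
have [N _ /(_ N (leqnn N)) NP] : \forall N \near \oo, @unit_cube R d `<=` P N.
  have /compact_near_coveringP := @compact_unit_cube R d; apply => p pI.
  have avoid s : \forall q \near p & N \near \oo,
      ~ (f @` simplex R (face s)) p ->
      ~ exists2 x, simplex R (face s) x & close_to N q (f x).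
    have [fp|nfp] := pselect ((f @` simplex R (face s)) p).
      by apply: filterE => -[q N] /(_ fp).
    have : nbhs p (~` (f @` simplex R (face s))).
      apply: open_nbhs_nbhs; split => //; apply: closed_openC.
      by apply: compact_closed (compact_face_image fc); exact: norm_hausdorff.
    move=> /near_close_to; apply: filterS => -[q N] /= h _ [x xs /h]; apply.
    by exists x.
  have : \forall q \near p & N \near \oo, forall s,
      ~ (f @` simplex R (face s)) p ->
      ~ exists2 x, simplex R (face s) x & close_to N q (f x).
    exact: (@filter_forall _ _ (fun s (x : 'rV[R]_d * nat) =>
      ~ (f @` simplex R (face s)) p ->
      ~ exists2 y, simplex R (face s) y & close_to x.2 x.1 (f y)) _ _ avoid).
  apply: filterS => -[q N] /= h.
  rewrite /P (leq_ltn_trans _ (few p)) // leq_mul2l subset_leq_card ?orbT //.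
  apply/fintype.subsetP => s; rewrite !inE => xs.
  by apply: contrapT => nfp; exact: (h s nfp xs).
(* The vertex [t ord0] serves as reference point of the cell: a face is bad if its image comes close
   to it. *)
have [||i v|t tc|z zP] := @greedy_avoid _ d.+1 n ((3 ^ d) ^ d.+1) (cells N)
    (fun t => near_faces N (grid_point (t ord0))).
- exact: n_gt0.
- by rewrite !expn_gt0.
- exact: card_cells_through.
- exact: NP (grid_point_cube _).
pose g := f \o vertex_map z.
have gI p : unit_cube p -> unit_cube (g p).
  by move=> /(vertex_map_simplex z)[t _ [/fI ? _]].
have [|p pI gp] := @brouwer_cube R d g _ gI.
  apply/subspace_continuousP => p pI.
  have vK q : unit_cube q -> join_realization (vertex_map z q).
    by move=> /(vertex_map_simplex z)[t _ [/simplex_face_sub ? _]].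
  have vc : vertex_map z @ within (@unit_cube R d) (nbhs p) -->
      within join_realization (nbhs (vertex_map z p : {ptws T -> R})).
    have vc : vertex_map z @ within (@unit_cube R d) (nbhs p) -->
        (vertex_map z p : {ptws T -> R}).
      apply: cvg_vertex_map => // j; apply: cvg_within_filter.
      exact: coord_continuous.
    move=> A /vc; rewrite !nbhs_simpl /=.
    apply: filterS2 (@withinT _ (nbhs p) (@unit_cube R d) _).
    by move=> q /vK vq; apply.
  move/subspace_continuousP : fc => /(_ _ (vK p pI)).
  exact: (@cvg_comp _ _ _ (vertex_map z) f _ _ _ vc).
(* A fixed point lies in the image of the face chosen for its cell and close to the reference
   vertex, which the choice of [z] forbids. *)
have [t tc [ts tp]] := vertex_map_simplex z pI.
have /negP := zP t tc; rewrite inE; apply; apply/asboolP.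
by exists (vertex_map z p) => //; rewrite -[f _]/(g p) gp.
Qed.

(** The face images are bounded, so an affine bijection [h] brings them into the unit cube, and the
    point found there is pulled back. *)
Lemma overlap_point (f : {ptws T -> R} -> 'rV[R]_d) : (0 < n)%N ->
  {within join_realization, continuous f} ->
  exists p, (n ^ d.+1 <= overlap_const * #|covering_faces f p|)%N.
Proof.
move=> n_gt0 fc.
have [B B_gt0 fB] : exists2 B : R, 0 < B &
    forall s x i, simplex R (face s) x -> `|f x ord0 i| <= B.
  have : \forall B \near +oo, forall s,
      forall y, (f @` simplex R (face s)) y -> `|y| <= B.
    apply: filter_forall => s.
    exact: compact_bounded (compact_face_image fc).
  move=> bnd; have /pinfty_ex_gt0[B B_gt0 fB] := bnd; exists B => // s x i xs.
  apply: le_trans (fB s (f x) _); last by exists x.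
  rewrite [leRHS]mx_normrE; by apply/bigmax_geP; right; exists (ord0, i).
pose h (y : 'rV[R]_d) := (2 * B)^-1 *: (y + const_mx B).
have B2 : 2 * B != 0 by rewrite mulf_neq0 ?gt_eqF.
have [||p le_p] := @overlap_cube (h \o f) n_gt0.
- apply/subspace_continuousP => x xK.
  move/subspace_continuousP : fc => /(_ x xK) fx.
  apply: (@cvg_comp _ _ _ f h _ _ _ fx); apply: cvgZr.
  by apply: cvgD; [exact: cvg_id | exact: cvg_cst].
- move=> s x xs i; rewrite !mxE; have := fB s x i xs.
  rewrite ler_norml => /andP[f1 f2].
  by rewrite mulr_ge0 ?invr_ge0 ?ler_pdivrMl ?mulr_gt0 //; lra.
exists (2 * B *: p - const_mx B); apply: leq_trans le_p _.
rewrite leq_mul2l subset_leq_card ?orbT //; apply/fintype.subsetP => s.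
rewrite !inE => -[x xs <-]; exists x => //.
by rewrite /h /= scalerA mulfV // scale1r addrK.
Qed.

Lemma tau_ge (f : {ptws T -> R} -> 'rV[R]_d) p m (Z : 'I_d.+1 -> {set 'I_n}) :
  (forall i, #|Z i| = m) ->
  (forall s, (forall i, s i \in Z i) -> s \in covering_faces f p) ->
  (m <= tau (@parts d n) f)%N.
Proof.
move=> Zm Zp; rewrite /tau; case: ex_maxnP => k _; apply; apply/asboolP.
exists (fun i => [set (i, a) | a in Z i]%SET); split.
  move=> i; split; last by rewrite card_imset // => a b [].
  by apply/fintype.subsetP => _ /imsetP[a _ ->]; rewrite inE.
exists p => z /= zZ.
pose s : {ffun 'I_d.+1 -> 'I_n} := [ffun i => (z i).2].
have zE i : z i = (i, s i) /\ s i \in Z i.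
  by rewrite ffunE; have /imsetP[a aZ ->] := zZ i.
have <- : face s = [set z i | i : 'I_d.+1]%SET.
  by apply: eq_imset => i; rewrite -(zE i).1.
by have := Zp s (fun i => (zE i).2); rewrite inE => /asboolP.
Qed.

End Overlap.

(** * From a heavily covered point to the logarithmic bound *)

Theorem theorem1p3 (R : realType) (d : nat) (d_ge1 : (1 <= d)%N) :
  exists c3 : R, 0 < c3 /\
    forall n : nat, (0 < n)%N ->
      c3 * (ln (n%:R : R)) `^ (d%:R^-1) <= (topological_pach_number R d n)%:R.
Proof.
pose K := overlap_const d.
have [L LE] : exists L, L = (4 * K)%N by exists (4 * K)%N.
have K_gt0 : (0 < K)%N by rewrite !expn_gt0.
have L_gt1 : (1 < L)%N by rewrite LE; lia.
(* Here [3 ^ d] comes from [m.+2 ^ d <= (3 * m) ^ d], and the 2 leaves room for the factor [m] in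
   the size condition of [erdos_box]. *)
pose C : R := (2 * 3 ^ d)%:R * ln L%:R.
have C_gt0 : 0 < C.
  by rewrite mulr_gt0 ?ltr0n ?muln_gt0 ?expn_gt0 // ln_gt0 // ltr1n.
exists (C^-1 `^ d%:R^-1 / 2); split.
  by rewrite divr_gt0 // powR_gt0 // invr_gt0.
move=> n n_gt0; rewrite /topological_pach_number /min_tau.
case: ex_minnP => _ /asboolP[f [fc <-]] _.
have [p le_p] := overlap_point n_gt0 fc.
have ln_ge0 : 0 <= ln (n%:R : R) by rewrite ln_ge0 // ler1n.
rewrite mulrAC -powRM ?invr_ge0 ?(ltW C_gt0) //.
set y := _ `^ _.
have y_ge0 : 0 <= y by exact: powR_ge0.
have yd : y ^+ d = C^-1 * ln n%:R.
  rewrite -powR_mulrn // -powRrM mulVf ?pnatr_eq0 -?lt0n // powRr1 //.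
  by rewrite mulr_ge0 // invr_ge0 ltW.
(* The size [m] is [y] rounded down; the factor [1/2] in the constant absorbs this, as
   [y < m + 1 <= 2 * m] for positive [m]. *)
have /andP[le_my lt_ym] := truncn_itv y_ge0.
set m := Num.truncn y in le_my lt_ym.
have [m0|m_gt0] := posnP m.
  (* Now [y < 1], and a single covering face gives [tau] at least 1. *)
  have /card_gt0P[s sp] : (0 < #|covering_faces f p|)%N.
    rewrite lt0n; apply: contraTneq le_p => ->.
    by rewrite muln0 -ltnNge expn_gt0 n_gt0.
  have le1 : (1 <= tau (@parts d n) f)%N.
    apply: (@tau_ge R d n f p 1 (fun i => [set s i]%SET)) => [i|t tZ].
      exact: cards1.
    rewrite (_ : t = s) //; apply/ffunP => i; have := tZ i; rewrite inE.
    by move/eqP.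
  rewrite m0 in lt_ym; apply: le_trans (_ : 1%:R <= _); last by rewrite ler_nat.
  lra.
have le_mn : (m * L ^ (m.+2 ^ d) <= n)%N.
  have le1 : (L ^ (2 * (3 * m) ^ d) <= n)%N.
    have L0 : 0 < L%:R :> R by rewrite ltr0n; exact: ltnW.
    have n0 : 0 < n%:R :> R by rewrite ltr0n.
    have CE : ln L%:R *+ (2 * (3 * m) ^ d) = C * m%:R ^+ d :> R.
      by rewrite -[LHS]mulr_natl expnMn mulnA natrM natrX mulrAC.
    rewrite -(ler_nat R) natrX -ler_ln ?posrE ?exprn_gt0 // lnXn //.
    rewrite CE -[leRHS](mulVKf (lt0r_neq0 C_gt0)) -yd ler_pM2l //.
    by rewrite lerXn2r ?nnegrE.
  apply: leq_trans le1; rewrite mul2n -addnn expnD leq_mul //.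
    apply: leq_trans (ltnW (ltn_expl m L_gt1)) _.
    rewrite leq_pexp2l ?(ltnW L_gt1) //.
    rewrite (leq_trans _ (leq_pexp2l (m := 3 * m) _ d_ge1)) ?muln_gt0 // expn1; lia.
  rewrite leq_pexp2l ?(ltnW L_gt1) // leq_exp2r //; lia.
rewrite LE in le_mn; have [Z Zm Zp] := @erdos_box d n m K _ K_gt0 m_gt0 le_mn le_p.
have le_m := tau_ge Zm Zp.
apply: le_trans (_ : m%:R <= _); last by rewrite ler_nat.
have m1 : 1 <= m%:R :> R by rewrite ler1n.
rewrite -natr1 in lt_ym; lra.
Qed.
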